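(* Let $d\ge1$. For integers $0\le m\le n$, $0\le j\le m/2$ and $1\le\ell\le\dim\mathcal H_{m-2j}^d$, $$e^{t}\big(\partial_{tt}-\Delta_x\big)\big[e^{-t}Q_{m,j,\ell}^{n,-1}(x,t)\big] = a_{m,j}\Big(Q_{m,j,\ell}^{n,0}(x,t)-b_{m,n}\,Q_{m-2,j-1,\ell}^{n,0}(x,t)\Big),$$ where $a_{m,j}=\frac{2m-2j+d-2}{2m+d-2}$ (with $a_{0,0}=1$ when $d=2$) and $b_{m,n}=(n-m+1)(n-m+2)$, and $Q_{m-2,j-1,\ell}^{n,0}:=0$ when $j=0$.
   Context: $\Delta_x$ is the Laplacian in $x\in\mathbb R^d$. For real $\alpha$ define $L_n^{\alpha}(t)=\sum_{k=0}^n \frac{(\alpha+k+1)_{n-k}}{(n-k)!}\frac{(-t)^k}{k!}$, and for real $\alpha,\beta$ define $P_n^{(\alpha,\beta)}(s)=\sum_{k=0}^n \frac{(\alpha+k+1)_{n-k}(n+\alpha+\beta+1)_k}{k!\,(n-k)!}\left(\frac{s-1}{2}\right)^k$ (classical Laguerre and Jacobi polynomials, extended polynomially in the parameters; in particular $P_0^{(-1,\beta)}=1$); $(a)_k$ is the Pochhammer symbol. For an integer $p\ge0$, $\mathcal H_p^d$ is the space of homogeneous harmonic polynomials of degree $p$ in $d$ variables (for $d=1$: $\mathcal H_0^1=\mathrm{span}\{1\}$, $\mathcal H_1^1=\mathrm{span}\{x\}$, $\mathcal H_p^1=\{0\}$ for $p\ge2$), and $\{Y_\ell^p\}$ is an orthonormal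 basis of it with respect to the normalized surface measure on $\mathbb S^{d-1}$. For $\mu\ge-1$ and integers $0\le m\le n$, $0\le j\le m/2$, $1\le\ell\le\dim\mathcal H^d_{m-2j}$, $$Q_{m,j,\ell}^{n,\mu}(x,t)=L_{n-m}^{2m+2\mu+d}(t)\,t^{2j}\,P_j^{(\mu,\,m-2j+\frac{d-2}{2})}\!\left(2\frac{\|x\|^2}{t^2}-1\right)Y_\ell^{m-2j}(x).$$ *)

(* Defs.v *)
From HB Require Import structures.
From mathcomp Require Import all_boot all_order all_algebra.
From mathcomp Require Import all_classical all_reals all_analysis.
From mathcomp Require mpoly.
Set Implicit Arguments. Unset Strict Implicit. Unset Printing Implicit Defensive.
Import Order.TTheory GRing.Theory Num.Theory.
Local Open Scope ring_scope.

Section Defs.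
Variable R : realType.

Definition poch (a : R) (k : nat) : R := \prod_(i < k) (a + i%:R).

Definition laguerre (n : nat) (alpha t : R) : R :=
  \sum_(k < n.+1) poch (alpha + k%:R + 1) (n - k) / (n - k)`!%:R
                  * (- t) ^+ k / k`!%:R.

Definition jacobi (n : nat) (alpha beta s : R) : R :=
  \sum_(k < n.+1) poch (alpha + k%:R + 1) (n - k)
                  * poch (n%:R + alpha + beta + 1) k / (k`! * (n - k)`!)%:R
                  * ((s - 1) / 2) ^+ k.

(* The polynomial t^(2j) P_j^(alpha,beta)(2 r2 / t^2 - 1), written out as a
   polynomial in (r2, t): since ((2 r2/t^2 - 1) - 1)/2 = (r2 - t^2)/t^2, the
   k-th term t^(2j) ((s-1)/2)^k equals (r2 - t^2)^k t^(2(j-k)).  This agrees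
   with the literal formula for t <> 0 and is its polynomial extension. *)
Definition hjacobi (j : nat) (alpha beta r2 t : R) : R :=
  \sum_(k < j.+1) poch (alpha + k%:R + 1) (j - k)
                  * poch (j%:R + alpha + beta + 1) k / (k`! * (j - k)`!)%:R
                  * (r2 - t ^+ 2) ^+ k * t ^+ (2 * (j - k)).

Definition sqnorm (d : nat) (x : 'rV[R]_d) : R := \sum_(i < d) x ord0 i ^+ 2.

Definition peval (d : nat) (Y : mpoly.mpoly d R) (x : 'rV[R]_d) : R :=
  mpoly.meval (fun i => x ord0 i) Y.

Definition harmonic_hom (d p : nat) (Y : mpoly.mpoly d R) : Prop :=
  all (fun mo => mpoly.mdeg mo == p) (mpoly.msupp Y) /\
  \sum_(i < d) mpoly.mderiv i (mpoly.mderiv i Y) = 0.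

(* Q^{n,mu}_{m,j}(x,t) built from the harmonic polynomial Y (in H^d_{m-2j}) *)
Definition Qfun (d n m j : nat) (mu : R) (Y : mpoly.mpoly d R)
    (x : 'rV[R]_d) (t : R) : R :=
  laguerre (n - m) (2 * m%:R + 2 * mu + d%:R) t
  * hjacobi j mu ((m - 2 * j)%:R + (d%:R - 2) / 2) (sqnorm x) t
  * peval Y x.

Definition d_tt (d : nat) (F : 'rV[R]_d -> R -> R) (x : 'rV[R]_d) (t : R) : R :=
  derive1 (derive1 (fun u => F x u)) t.

Definition lap_x (d : nat) (F : 'rV[R]_d -> R -> R) (x : 'rV[R]_d) (t : R) : R :=
  \sum_(i < d) derive1 (derive1 (fun s : R => F (x + s *: delta_mx ord0 i) t)) 0.

Definition acoef (d m j : nat) : R :=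
  if (2 * m + d == 2)%N then 1
  else ((2 * m - 2 * j + d)%:R - 2) / ((2 * m + d)%:R - 2).

Definition bcoef (m n : nat) : R := ((n - m + 1) * (n - m + 2))%:R.

End Defs.

(* Main.v *)
(* Let alpha = 2m + d - 2, beta = m - 2j + (d - 2)/2, g = e^{-t} L_{n-m}^alpha,
   h = t^{2j} P_j^{(-1,beta)} and K_i = t^{2i} P_i^{(0,beta)}, all Jacobi
   polynomials being taken at 2 |x|^2/t^2 - 1.  Since Y is harmonic and
   homogeneous, the wave operator sends g h Y to
   (g'' h + 2 g' h_t + g (h_tt - 4 r h_rr - (4 beta + 4) h_r)) Y, r = |x|^2.
   Here g' = - e^{-t} L^{alpha+1} and g'' = e^{-t} L^{alpha+2}.  Expanding in
   powers of r - t^2 and t^2 one finds, for j > 0,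
     (2j + beta) h = (j + beta) (K_j - t^2 K_{j-1}),
     h_t = - 2 (j + beta) t K_{j-1},
     h_tt - 4 r h_rr - (4 beta + 4) h_r
       = - 2 (j + beta) (alpha - 1) K_{j-1},
   and the coefficient of K_{j-1} is collected by
     (N+1)(N+2) L_{N+2}^{alpha-2}
       = alpha (alpha-1) L_N^alpha - 2 alpha t L_N^{alpha+1} + t^2 L_N^{alpha+2}. *)
Require Import Defs.
From HB Require Import structures.
From mathcomp Require Import all_boot all_order all_algebra.
From mathcomp Require Import all_classical all_reals all_analysis.
From mathcomp Require mpoly.
(* Importing all of mpoly would clash with the notations of MathComp-Analysis. *)
Import (coercions, canonicals) mpoly.
From mathcomp Require Import ring zify.
Import Order.TTheory GRing.Theory Num.Theory.
Set Implicit Arguments.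
Unset Strict Implicit.
Unset Printing Implicit Defensive.
Local Open Scope ring_scope.

(** * Derivatives of real functions, with values in ring operations *)

Section PointwiseDerivatives.
Context {R : realType}.
Implicit Types (f g : R -> R) (x a : R).

Lemma is_derive_fun_cst a x : is_derive x (1 : R) (fun=> a) 0.
Proof. exact: is_derive_cst. Qed.

Lemma is_derive_fun_id x : is_derive x (1 : R) (fun s => s) 1.
Proof. exact: is_derive_id. Qed.

Lemma is_derive_fun_add f g x df dg :
  is_derive x (1 : R) f df -> is_derive x (1 : R) g dg ->
  is_derive x (1 : R) (fun s => f s + g s) (df + dg).
Proof. exact: is_deriveD. Qed.

Lemma is_derive_fun_opp f x df :
  is_derive x (1 : R) f df -> is_derive x (1 : R) (fun s => - f s) (- df).
Proof. exact: is_deriveN. Qed.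

Lemma is_derive_fun_mul f g x df dg :
  is_derive x (1 : R) f df -> is_derive x (1 : R) g dg ->
  is_derive x (1 : R) (fun s => f s * g s) (df * g x + f x * dg).
Proof.
move=> hf hg; have := is_deriveM hf hg.
by rewrite /GRing.scale /= addrC [g x * df]mulrC.
Qed.

Lemma is_derive_fun_exp f n x df :
  is_derive x (1 : R) f df ->
  is_derive x (1 : R) (fun s => f s ^+ n) (n%:R * f x ^+ n.-1 * df).
Proof.
move=> hf; elim: n => [|n IH] /=.
  by rewrite !mul0r; apply: is_derive_fun_cst.
apply: is_derive_eq.
  rewrite (_ : (fun s => f s ^+ n.+1) = (fun s => f s * f s ^+ n)); last first.
    by apply/funext => s; rewrite exprS.
  exact: is_derive_fun_mul hf IH.
(* For [n = 0] the truncated exponent [n.-1] comes with the factor [0], so it does no harm. *)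
case: n IH => [|n] _ /=; first by ring.
by rewrite [_ ^+ n.+1]exprS -(natr1 n.+1); ring.
Qed.

Lemma is_derive_fun_comp f g x df dg :
  is_derive (g x) (1 : R) f df -> is_derive x (1 : R) g dg ->
  is_derive x (1 : R) (fun s => f (g s)) (df * dg).
Proof.
move=> hf hg; have := is_derive1_comp hf hg.
by rewrite /GRing.scale /= mulrC.
Qed.

Lemma is_derive_fun_sum (I : Type) (r : seq I) (F : I -> R -> R) (dF : I -> R) x :
  (forall i, is_derive x (1 : R) (F i) (dF i)) ->
  is_derive x (1 : R) (fun s => \sum_(i <- r) F i s) (\sum_(i <- r) dF i).
Proof.
move=> dFi; elim: r => [|i r IH].
  rewrite big_nil (_ : (fun s => _) = fun=> 0); last first.
    by apply/funext => s; rewrite big_nil.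
  exact: is_derive_fun_cst.
rewrite big_cons (_ : (fun s => _) = fun s => F i s + \sum_(k <- r) F k s).
  exact: is_derive_fun_add.
by apply/funext => s; rewrite big_cons.
Qed.

Lemma derive1_fun f df :
  (forall x, is_derive x (1 : R) f (df x)) -> derive1 f = df.
Proof.
by move=> h; apply/funext => x; rewrite derive1E; have [_ ->] := h x.
Qed.

End PointwiseDerivatives.

(* notypeclasses keeps the library instances, whose derivative values are
   expressed by scaling, from solving the premises. *)
Ltac prove_is_derive :=
  first
  [ eassumption
  | match goal with h : forall s, is_derive s _ _ _ |- _ => exact: h end
  | notypeclasses refine (is_derive_fun_cst _ _)
  | notypeclasses refine (is_derive_fun_id _)
  | notypeclasses refine (is_derive_fun_sum _ (fun _ => _)); prove_is_derive
  | notypeclasses refine (is_derive_fun_opp _); prove_is_derive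
  | notypeclasses refine (is_derive_fun_exp _ _); prove_is_derive
  | notypeclasses refine (is_derive_fun_add _ _); prove_is_derive
  | notypeclasses refine (is_derive_fun_mul _ _); prove_is_derive ].

Ltac derive_to :=
  lazymatch goal with |- is_derive ?x ?v ?f _ =>
    let h := fresh in
    eassert (h : is_derive x v f _) by prove_is_derive;
    refine (is_derive_eq h _); clear h; cbv beta
  end.

(** * Pochhammer symbols and Laguerre polynomials *)

Lemma pochSr (R : realType) (a : R) k : poch a k.+1 = poch a k * (a + k%:R).
Proof. by rewrite /poch big_ord_recr. Qed.

Lemma pochSl (R : realType) (a : R) k : poch a k.+1 = a * poch (a + 1) k.
Proof.
rewrite /poch big_ord_recl addr0; congr (_ * _).
by apply: eq_bigr => i _; rewrite lift0 -addn1 natrD addrAC addrA.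
Qed.

Lemma natr_fact_neq0 (R : realType) k : k`!%:R != 0 :> R.
Proof. by rewrite pnatr_eq0 -lt0n fact_gt0. Qed.

Definition laguerre_coef (R : realType) n (alpha : R) k :=
  poch (alpha + k%:R + 1) (n - k) / ((n - k)`!%:R * k`!%:R).

Lemma laguerreE (R : realType) n (alpha t : R) :
  laguerre n alpha t = \sum_(k < n.+1) laguerre_coef n alpha k * (- t) ^+ k.
Proof.
apply: eq_bigr => k _; rewrite /laguerre_coef invfM.
by rewrite -!mulrA; do 2!congr (_ * _); rewrite mulrC.
Qed.

Lemma laguerre_contiguous (R : realType) n (alpha t : R) :
  n.+1%:R * laguerre n.+1 (alpha - 1) t =
  alpha * laguerre n alpha t - t * laguerre n (alpha + 1) t.
Proof.
(* The factor [- t] shifts the last sum by one power of [- t]. Splitting off the powers [0] and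
   [n.+1] aligns the sums over the powers from [1] to [n]. *)
rewrite !laguerreE !mulr_sumr -sumrN [in LHS]big_ord_recl.
rewrite [X in _ + X]big_ord_recr [X in _ = X + _]big_ord_recl.
rewrite [X in _ = _ + X]big_ord_recr /= -!addrA.
congr (_ + _).
  rewrite /laguerre_coef !subn0 expr0 !addr0 !mulr1 subrK.
  rewrite pochSl factS natrM -!(natr1 n).
  have := natr_fact_neq0 R n; have : n%:R + 1 != 0 :> R by rewrite natr1 pnatr_eq0.
  by move=> h1 h2; field; rewrite h1 h2.
rewrite !addrA -big_split /=; congr (_ + _).
  apply: eq_bigr => k _; rewrite /laguerre_coef /bump leq0n add1n.
  have kn : (k < n)%N by [].
  have -> : (n.+1 - k.+1 = (n - k.+1).+1)%N by lia.
  have -> : (n - k = (n - k.+1).+1)%N by lia.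
  (* With [l] for [n - k.+1], truncated subtraction disappears and the comparison becomes a field
     identity in [l], [k] and [alpha]. *)
  have E : n%:R = (n - k.+1)%:R + k%:R + 1 :> R.
    by rewrite -natrD natr1; congr GRing.natmul; lia.
  move: (n - k.+1)%N E => l E.
  rewrite exprS.
  have -> : alpha - 1 + k.+1%:R + 1 = alpha + k%:R + 1 by rewrite -(natr1 k); ring.
  have -> : alpha + 1 + k%:R + 1 = alpha + k%:R + 1 + 1 by ring.
  have -> : alpha + k.+1%:R + 1 = alpha + k%:R + 1 + 1 by rewrite -(natr1 k); ring.
  rewrite pochSl pochSr !factS !natrM -!(natr1 n) E -(natr1 k) -(natr1 l).
  have h1 := natr_fact_neq0 R l; have h2 := natr_fact_neq0 R k.
  have h3 : l%:R + 1 != 0 :> R by rewrite natr1 pnatr_eq0.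
  have h4 : k%:R + 1 != 0 :> R by rewrite natr1 pnatr_eq0.
  by field; rewrite h1 h2 h3 h4.
rewrite /laguerre_coef /bump leq0n add1n !subnn /poch !big_ord0.
rewrite ?fact0 factS natrM exprS -!(natr1 n).
have := natr_fact_neq0 R n; have : n%:R + 1 != 0 :> R by rewrite natr1 pnatr_eq0.
by move=> h1 h2; field; rewrite h1 h2.
Qed.

(** The contiguous relation is applied at [alpha - 1], then at [alpha] and [alpha + 1]; the factors
    [alpha - 1] and [alpha + 1] of the middle term add up to [2 * alpha]. *)
Lemma laguerre_contiguous2 (R : realType) n (alpha t : R) :
  (n.+1 * n.+2)%:R * laguerre n.+2 (alpha - 2) t =
  alpha * (alpha - 1) * laguerre n alpha t
  - 2 * alpha * t * laguerre n (alpha + 1) t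
  + t ^+ 2 * laguerre n (alpha + 2) t.
Proof.
have -> : alpha - 2 = alpha - 1 - 1 by ring.
rewrite natrM -mulrA laguerre_contiguous mulrBr mulrCA laguerre_contiguous.
rewrite subrK mulrCA.
have := laguerre_contiguous n (alpha + 1) t; rewrite addrK => ->.
have -> : alpha + 2 = alpha + 1 + 1 by ring.
by ring.
Qed.

(** This form of the classical derivative, minus the polynomial of degree [n - 1] and parameter
    [alpha + 1], keeps the degree [n] and also covers [n = 0]. *)
Lemma is_derive_laguerre (R : realType) n (alpha t : R) :
  is_derive t (1 : R) (laguerre n alpha)
    (laguerre n alpha t - laguerre n (alpha + 1) t).
Proof.
have -> : laguerre n alpha =
    fun s => \sum_(k < n.+1) laguerre_coef n alpha k * (- s) ^+ k.
  by apply/funext => s; rewrite laguerreE.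
have dk (k : 'I_n.+1) : is_derive t (1 : R)
    (fun s => laguerre_coef n alpha k * (- s) ^+ k)
    (laguerre_coef n alpha k * (- (k%:R * (- t) ^+ k.-1))).
  by derive_to; ring.
apply: is_derive_eq; first exact: is_derive_fun_sum dk.
(* The term [k = 0] of the derivative vanishes, and the top coefficients on the right cancel because
   they do not depend on [alpha]; the rest agrees after a shift by one. *)
rewrite !laguerreE -sumrB big_ord_recl big_ord_recr /= mul0r oppr0 mulr0 add0r.
rewrite /laguerre_coef !subnn /poch !big_ord0 subrr addr0 -/poch.
apply: eq_bigr => k _; rewrite /= /bump leq0n add1n /=.
have kn : (k < n)%N by [].
have -> : (n - k = (n - k.+1).+1)%N by lia.
move: (n - k.+1)%N => l.
have -> : alpha + 1 + k%:R + 1 = alpha + k%:R + 1 + 1 by ring.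
have -> : alpha + k.+1%:R + 1 = alpha + k%:R + 1 + 1 by rewrite -(natr1 k); ring.
rewrite -!/(poch _ _) pochSl pochSr !factS !natrM -(natr1 k) -(natr1 l).
have h1 := natr_fact_neq0 R l; have h2 := natr_fact_neq0 R k.
have h3 : l%:R + 1 != 0 :> R by rewrite natr1 pnatr_eq0.
have h4 : k%:R + 1 != 0 :> R by rewrite natr1 pnatr_eq0.
by field; rewrite h1 h2 h3 h4.
Qed.

(** The derivative of the exponential cancels the first term of [is_derive_laguerre], so each
    differentiation only raises [alpha] by one and changes the sign. *)
Lemma is_derive_exp_laguerre (R : realType) n (alpha t : R) :
  is_derive t (1 : R) (fun s => expR (- s) * laguerre n alpha s)
    (- (expR (- t) * laguerre n (alpha + 1) t)).
Proof.
have dE : is_derive t (1 : R) (fun s => expR (- s)) (- expR (- t)).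
  rewrite -mulrN1.
  exact: (is_derive_fun_comp (is_derive_expR (- t))
    (is_derive_fun_opp (is_derive_fun_id t))).
have dL := is_derive_laguerre n alpha t.
by derive_to; ring.
Qed.

(** * Homogeneous polynomials in [v] and [t ^+ 2], handled through their coefficients *)

Section HomogeneousSums.
Context {R : realType}.
Implicit Types (n : nat) (c : nat -> R) (u v t : R).

(* Homogeneous in |x| and t; below v stands for |x|^2 - t^2. *)
Definition hsum n c v t := \sum_(k < n.+1) c k * v ^+ k * t ^+ (2 * (n - k)).

(** The partial derivatives treat [v] and [t] as independent; the dependence of [v] on [t] enters
    through the chain rule in [is_derive_hsum]. *)
Definition hsum_dv n c v t :=
  \sum_(k < n.+1) c k * (k%:R * v ^+ k.-1) * t ^+ (2 * (n - k)).

Definition hsum_dt n c v t :=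
  \sum_(k < n.+1) c k * v ^+ k
    * ((2 * (n - k))%:R * t ^+ (2 * (n - k)).-1).

Lemma is_derive_hsum n c (v t : R -> R) s dv dt :
  is_derive s (1 : R) v dv -> is_derive s (1 : R) t dt ->
  is_derive s (1 : R) (fun z => hsum n c (v z) (t z))
    (hsum_dv n c (v s) (t s) * dv + hsum_dt n c (v s) (t s) * dt).
Proof.
move=> hv ht; rewrite /hsum_dv /hsum_dt !mulr_suml -big_split /=.
apply: is_derive_fun_sum => k.
by derive_to; ring.
Qed.

Lemma eq_hsum n c c' v t :
  (forall k, (k <= n)%N -> c k = c' k) -> hsum n c v t = hsum n c' v t.
Proof. by move=> e; apply: eq_bigr => k _; rewrite e // -ltnS. Qed.

Lemma hsumZ n a c v t : a * hsum n c v t = hsum n (fun k => a * c k) v t.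
Proof. by rewrite /hsum mulr_sumr; apply: eq_bigr => k _; rewrite !mulrA. Qed.

Lemma hsumD n c c' v t :
  hsum n c v t + hsum n c' v t = hsum n (fun k => c k + c' k) v t.
Proof. by rewrite /hsum -big_split; apply: eq_bigr => k _; rewrite /= !mulrDl. Qed.

(** Without the top coefficient every remaining term contains [t ^+ 2]. *)
Lemma hsumS n c v t : c n.+1 = 0 -> hsum n.+1 c v t = t ^+ 2 * hsum n c v t.
Proof.
move=> c0; rewrite /hsum big_ord_recr /= c0 !mul0r addr0 mulr_sumr.
apply: eq_bigr => k _; have kn : (k < n.+1)%N by [].
have -> : (2 * (n.+1 - k) = 2 + 2 * (n - k))%N by lia.
by rewrite exprD; ring.
Qed.

Lemma hsum_dvS n c v t :
  hsum_dv n.+1 c v t = hsum n (fun k => k.+1%:R * c k.+1) v t.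
Proof.
rewrite /hsum_dv /hsum big_ord_recl /= mul0r mulr0 mul0r add0r.
apply: eq_bigr => k _; rewrite /bump leq0n add1n subSS /=; ring.
Qed.

Lemma hsum_dtS n c v t :
  hsum_dt n.+1 c v t = t * hsum n (fun k => 2 * (n.+1 - k)%:R * c k) v t.
Proof.
rewrite /hsum_dt /hsum big_ord_recr /= subnn muln0 mul0r mulr0 addr0 mulr_sumr.
apply: eq_bigr => k _; have kn : (k < n.+1)%N by [].
have -> : ((2 * (n.+1 - k)).-1 = (2 * (n - k)).+1)%N by lia.
by rewrite natrM exprS; ring.
Qed.

(** The operators [v d/dv] and [t d/dt] act diagonally on monomials, so the degree stays and
    identities reduce to coefficients by [eq_hsum]. *)
Lemma mul_v_hsum_dv n c v t :
  v * hsum_dv n c v t = hsum n (fun k => k%:R * c k) v t.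
Proof.
rewrite /hsum_dv /hsum mulr_sumr; apply: eq_bigr => -[[|k] ?] _ /=.
  by rewrite !(mul0r, mulr0).
by rewrite exprS; ring.
Qed.

(** The factor [t ^+ 2] restores the degree lost by differentiation; the condition on [c n.+1] makes
    the new top coefficient zero. *)
Lemma mul_t2_hsum_dv n c v t : c n.+1 = 0 ->
  t ^+ 2 * hsum_dv n c v t = hsum n (fun k => k.+1%:R * c k.+1) v t.
Proof.
move=> c0; case: n c0 => [|n] c0.
  by rewrite /hsum_dv /hsum !big_ord_recl !big_ord0 /= c0 !(mul0r, mulr0, addr0).
by rewrite hsum_dvS -hsumS // c0 mulr0.
Qed.

Lemma mul_t_hsum_dt n c v t :
  t * hsum_dt n c v t = hsum n (fun k => 2 * (n - k)%:R * c k) v t.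
Proof.
rewrite /hsum_dt /hsum mulr_sumr; apply: eq_bigr => k _.
rewrite natrM; case: (n - k)%N => [|l]; first by rewrite !(mul0r, mulr0).
have -> : ((2 * l.+1).-1 = (2 * l).+1)%N by lia.
have -> : (2 * l.+1 = (2 * l).+2)%N by lia.
by rewrite !exprS; ring.
Qed.

End HomogeneousSums.

(** * Jacobi polynomials with first parameter [0] and [-1] *)

Section JacobiCoefficients.
Context {R : realType}.
Implicit Types (n k : nat) (b u v t : R).

(** The binomial form has the value [0] at [k = n.+1], as required by [hsumS] and
    [mul_t2_hsum_dv]. *)
Definition jacobi0_coef n b k := 'C(n, k)%:R * poch (n%:R + 1 + b) k / k`!%:R.

(** These belong to degree [n.+1]. For first parameter [-1] the Pochhammer factor at [k = 0] starts
    with [0], hence no constant term; the other coefficients share the base [n%:R + 1 + b] with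
    [jacobi0_coef n]. *)
Definition jacobiN1_coef n b k :=
  if k is l.+1 then 'C(n, l)%:R * poch (n%:R + 1 + b) k / k`!%:R else 0.

Lemma poch_fact k l : poch (k%:R + 1 : R) l = (k + l)`!%:R / k`!%:R.
Proof.
elim: l => [|l IH].
  by rewrite /poch big_ord0 addn0 divff // natr_fact_neq0.
rewrite pochSr IH addnS factS natrM -natr1 natrD; ring.
Qed.

Lemma natr_bin n k : (k <= n)%N ->
  'C(n, k)%:R = n`!%:R / (k`!%:R * (n - k)`!%:R) :> R.
Proof.
move=> kn; rewrite -(bin_fact kn) !natrM mulfK //.
Qed.

Lemma hjacobi0E n b u t :
  hjacobi n 0 b u t = hsum n (jacobi0_coef n b) (u - t ^+ 2) t.
Proof.
apply: eq_bigr => k _; congr (_ * _ * _).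
have kn : (k <= n)%N by rewrite -ltnS.
rewrite /jacobi0_coef add0r addr0 poch_fact subnKC // natr_bin // natrM.
rewrite (_ : n%:R + b + 1 = n%:R + 1 + b); last by ring.
by field; rewrite !natr_fact_neq0.
Qed.

Lemma hjacobiN1E n b u t :
  hjacobi n.+1 (-1) b u t = hsum n.+1 (jacobiN1_coef n b) (u - t ^+ 2) t.
Proof.
apply: eq_bigr => -[[|k] kn] _; congr (_ * _ * _) => /=.
  by rewrite addr0 addNr subn0 pochSl !mul0r.
rewrite !ltnS in kn.
rewrite subSS (_ : -1 + k.+1%:R + 1 = k%:R + 1 :> R); last first.
  by rewrite -natr1; ring.
rewrite poch_fact subnKC // natr_bin // natrM.
rewrite (_ : n.+1%:R + -1 + b + 1 = n%:R + 1 + b); last by rewrite -natr1; ring.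
by field; rewrite !natr_fact_neq0.
Qed.

Lemma natr_bin_succ n k : (k <= n)%N ->
  k.+1%:R * 'C(n, k.+1)%:R = (n%:R - k%:R) * 'C(n, k)%:R :> R.
Proof. by move=> kn; rewrite -natrB // -!natrM mul_bin_left. Qed.

(** This term ratio of the hypergeometric sum takes the place of the Jacobi differential equation in
    [hjacobiN1_wave]. *)
Lemma jacobi0_coefS n b k : (k <= n)%N ->
  k.+1%:R ^+ 2 * jacobi0_coef n b k.+1
  = (n%:R - k%:R) * (n%:R + 1 + b + k%:R) * jacobi0_coef n b k.
Proof.
move=> kn; have := natr_bin_succ kn; rewrite /jacobi0_coef pochSr factS natrM.
have h1 := natr_fact_neq0 R k.
have h2 : k%:R + 1 != 0 :> R by rewrite natr1 pnatr_eq0.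
rewrite -!(natr1 k) => E.
transitivity ((k%:R + 1) * 'C(n, k.+1)%:R * (poch (n%:R + 1 + b) k *
  (n%:R + 1 + b + k%:R)) / k`!%:R); first by field; rewrite h1 h2.
by rewrite E; ring.
Qed.

Lemma jacobiN1_coefS n b k :
  k.+1%:R * jacobiN1_coef n b k.+1
  = (n%:R + 1 + b + k%:R) * jacobi0_coef n b k.
Proof.
rewrite /= /jacobi0_coef pochSr factS natrM.
have h1 := natr_fact_neq0 R k.
have h2 : k%:R + 1 != 0 :> R by rewrite natr1 pnatr_eq0.
by rewrite -!(natr1 k); field; rewrite h1 h2.
Qed.

Lemma jacobiN1_coef_jacobi0 n b k : (k <= n)%N ->
  (n.+1 - k)%:R * jacobiN1_coef n b k = k%:R * jacobi0_coef n b k.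
Proof.
case: k => [|k] kn; first by rewrite mul0r mulr0.
rewrite /= /jacobi0_coef !mulrA natr_bin_succ ?natrB 1?ltnW //.
by rewrite -!natr1; ring.
Qed.

Lemma jacobiN1_coef_diff n b k : (k <= n.+1)%N ->
  (2 * n.+1%:R + b) * jacobiN1_coef n b k
  = (n.+1%:R + b) * (jacobi0_coef n.+1 b k - jacobi0_coef n b k).
Proof.
(* Absorbing [n.+1%:R + b] brings both Pochhammer symbols to the base [n%:R + 1 + b]; Pascal's rule
   and [natr_bin_succ] then finish the comparison. *)
have E : (n.+1%:R + b) * poch (n.+1%:R + 1 + b) k
    = poch (n%:R + 1 + b) k * (n%:R + 1 + b + k%:R).
  rewrite -pochSr pochSl -natr1; congr (_ * poch _ _); ring.
rewrite mulrBr /jacobi0_coef mulrA [_ * (_ * poch _ _)]mulrCA E.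
case: k {E} => [|k] kn.
  by rewrite !bin0 /poch !big_ord0 -!natr1 /=; ring.
have := natr_bin_succ (kn : (k <= n)%N).
rewrite binS natrD /= -!(natr1 n) -(natr1 k) => E.
transitivity (poch (n%:R + 1 + b) k.+1 / k.+1`!%:R *
  ('C(n, k)%:R * (n%:R + 1 + b + (k%:R + 1)) + (k%:R + 1) * 'C(n, k.+1)%:R)).
  by rewrite E; ring.
ring.
Qed.

Lemma hjacobi_diff n b u t :
  (2 * n.+1%:R + b) * hjacobi n.+1 (-1) b u t
  = (n.+1%:R + b) * (hjacobi n.+1 0 b u t - t ^+ 2 * hjacobi n 0 b u t).
Proof.
rewrite !hjacobi0E hjacobiN1E -hsumS; last first.
  by rewrite /jacobi0_coef bin_small // !mul0r.
rewrite -[- hsum _ _ _ _]mulN1r !hsumZ hsumD hsumZ; apply: eq_hsum => k kn.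
by rewrite mulN1r jacobiN1_coef_diff.
Qed.

(** After extraction of [t], the [v]-part contributes [-2 * (n.+1%:R + b + k%:R)] and the explicit
    [t]-part [2 * k%:R] times the same coefficient, so the dependence on [k] cancels. *)
Lemma is_derive_hjacobiN1_t n b u t :
  is_derive t (1 : R) (hjacobi n.+1 (-1) b u)
    (- 2 * (n.+1%:R + b) * t * hjacobi n 0 b u t).
Proof.
rewrite (_ : hjacobi _ _ _ _ =
    fun s => hsum n.+1 (jacobiN1_coef n b) (u - s ^+ 2) s); last first.
  by apply/funext => s; rewrite hjacobiN1E.
have dv : is_derive t (1 : R) (fun s => u - s ^+ 2) (- 2 * t).
  by derive_to; ring.
refine (is_derive_eq (is_derive_hsum _ _ dv (is_derive_fun_id t)) _).
rewrite /= hsum_dvS hsum_dtS hjacobi0E.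
set S1 := hsum _ _ _ _; set S2 := hsum _ _ _ _; set S3 := hsum _ _ _ _.
suff : -2 * S1 + S2 = -2 * (n.+1%:R + b) * S3.
  move=> E; transitivity (t * (-2 * S1 + S2)); first by ring.
  by rewrite E; ring.
rewrite /S1 /S2 /S3 !hsumZ hsumD; apply: eq_hsum => k kn.
rewrite jacobiN1_coefS -mulrA jacobiN1_coef_jacobi0 // -natr1; ring.
Qed.

Definition hjacobi0_dt n b u t :=
  - 2 * t * hsum_dv n (jacobi0_coef n b) (u - t ^+ 2) t
  + hsum_dt n (jacobi0_coef n b) (u - t ^+ 2) t.

Lemma is_derive_hjacobi0_t n b u t :
  is_derive t (1 : R) (hjacobi n 0 b u) (hjacobi0_dt n b u t).
Proof.
rewrite (_ : hjacobi _ _ _ _ =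
    fun s => hsum n (jacobi0_coef n b) (u - s ^+ 2) s); last first.
  by apply/funext => s; rewrite hjacobi0E.
have dv : is_derive t (1 : R) (fun s => u - s ^+ 2) (- 2 * t).
  by derive_to; ring.
refine (is_derive_eq (is_derive_hsum _ _ dv (is_derive_fun_id t)) _).
by rewrite /hjacobi0_dt /=; ring.
Qed.

(** Differentiation in [u] lowers the degree to [n]; by [jacobiN1_coefS] the result is expressed
    through [jacobi0_coef], so a single family of coefficients remains. *)
Definition jacobiN1_dcoef n b k := (n%:R + 1 + b + k%:R) * jacobi0_coef n b k.

Definition hjacobiN1_du n b u t := hsum n (jacobiN1_dcoef n b) (u - t ^+ 2) t.

Definition hjacobiN1_duu n b u t := hsum_dv n (jacobiN1_dcoef n b) (u - t ^+ 2) t.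

Lemma is_derive_hjacobiN1_u n b u t :
  is_derive u (1 : R) (fun w => hjacobi n.+1 (-1) b w t) (hjacobiN1_du n b u t).
Proof.
rewrite (_ : (fun w => _) =
    fun w => hsum n.+1 (jacobiN1_coef n b) (w - t ^+ 2) t); last first.
  by apply/funext => s; rewrite hjacobiN1E.
have dv : is_derive u (1 : R) (fun w => w - t ^+ 2) 1 by derive_to; ring.
refine (is_derive_eq (is_derive_hsum _ _ dv (is_derive_fun_cst t u)) _).
rewrite mulr0 addr0 mulr1 hsum_dvS; apply: eq_hsum => k kn.
exact: jacobiN1_coefS.
Qed.

Lemma is_derive_hjacobiN1_uu n b u t :
  is_derive u (1 : R) (fun w => hjacobiN1_du n b w t) (hjacobiN1_duu n b u t).
Proof.
have dv : is_derive u (1 : R) (fun w => w - t ^+ 2) 1 by derive_to; ring.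
refine (is_derive_eq (is_derive_hsum _ _ dv (is_derive_fun_cst t u)) _).
by rewrite mulr0 addr0 mulr1.
Qed.

Lemma hjacobiN1_wave n b u t :
  - 2 * (n.+1%:R + b) * (hjacobi n 0 b u t + t * hjacobi0_dt n b u t)
  - 4 * u * hjacobiN1_duu n b u t - (4 * b + 4) * hjacobiN1_du n b u t
  = - 2 * (n.+1%:R + b) * (4 * n%:R + 2 * b + 3) * hjacobi n 0 b u t.
Proof.
rewrite /hjacobiN1_duu /hjacobiN1_du /hjacobi0_dt hjacobi0E.
(* This splits [u * hjacobiN1_duu] into a diagonal part and a part that shifts the coefficients by
   one. *)
set v := u - t ^+ 2; have -> : u = v + t ^+ 2 by rewrite /v subrK.
set e := jacobi0_coef n b; set c := jacobiN1_dcoef n b.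
have e0 : e n.+1 = 0 by rewrite /e /jacobi0_coef bin_small // !mul0r.
have c0 : c n.+1 = 0 by rewrite /c /jacobiN1_dcoef -/e e0 mulr0.
transitivity (- 2 * (n.+1%:R + b) * (hsum n e v t
   + (-2 * (t ^+ 2 * hsum_dv n e v t) + t * hsum_dt n e v t))
   + ((- 4) * (v * hsum_dv n c v t + t ^+ 2 * hsum_dv n c v t)
   + - (4 * b + 4) * hsum n c v t)); first by ring.
rewrite mul_v_hsum_dv !mul_t2_hsum_dv // mul_t_hsum_dt.
rewrite !(hsumZ, hsumD); apply: eq_hsum => k kn.
rewrite /c /jacobiN1_dcoef -/e natrB //.
have := jacobi0_coefS b kn; rewrite -/e -!natr1 => /eqP.
rewrite -subr_eq0 => /eqP E.
apply/eqP; rewrite -subr_eq0; apply/eqP.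
(* The terms in [e k.+1] have factors [4 (k+1) (n+1+b)] and [-4 (k+1) (n+2+b+k)], whose sum is
   [-4 (k+1)^2]; what is left is a multiple of [jacobi0_coefS]. *)
transitivity (- 4 * ((k%:R + 1) ^+ 2 * e k.+1
   - (n%:R - k%:R) * (n%:R + 1 + b + k%:R) * e k)); first by ring.
by rewrite E mulr0.
Qed.

End JacobiCoefficients.

(** * Laplacian of a radial function times a harmonic polynomial, and the wave operator on separated
    products *)

Section Laplacian.
Context {R : realType} {d : nat}.
Implicit Types (Y : mpoly.mpoly d R) (x : 'rV[R]_d) (i : 'I_d) (s : R).

Lemma line_coord x s i k :
  (x + s *: delta_mx ord0 i) ord0 k = if k == i then x ord0 i + s else x ord0 k.
Proof.
rewrite !mxE eqxx; case: eqP => [->|_]; first by rewrite mulr1.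
by rewrite mulr0 addr0.
Qed.

Lemma is_derive_peval Y x i s :
  is_derive s (1 : R) (fun s => peval Y (x + s *: delta_mx ord0 i))
    (peval (mpoly.mderiv i Y) (x + s *: delta_mx ord0 i)).
Proof.
(* Only coordinate [i] moves along the line, so isolating its power makes each monomial a function
   of one variable. *)
rewrite (_ : (fun s => _) = fun s => \sum_(m <- mpoly.msupp Y)
    mpoly.mcoeff m Y * ((x ord0 i + s) ^+ m i *
      \prod_(k < d | k != i) x ord0 k ^+ m k)); last first.
  apply/funext => z; rewrite /peval mpoly.mevalE; apply: eq_bigr => m _.
  congr (_ * _); rewrite (bigD1 i) //= line_coord eqxx; congr (_ * _).
  by apply: eq_bigr => k /negbTE ki; rewrite line_coord ki.
derive_to.
rewrite /peval /mpoly.mderiv raddf_sum; apply: eq_bigr => m _ /=.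
rewrite mpoly.mevalZ mpoly.mevalX [in RHS](bigD1 i) //= line_coord eqxx.
rewrite mpoly.mnmBE mpoly.mnm1E eqxx subn1.
rewrite [X in _ = _ * (_ * X)](eq_bigr (fun k => x ord0 k ^+ m k)); last first.
  move=> k /negbTE ki.
  by rewrite line_coord ki mpoly.mnmBE mpoly.mnm1E eq_sym ki subn0.
by ring.
Qed.

(** On a monomial, [x_i d/dx_i] multiplies by the exponent of [x_i], and the exponents add up to
    [p]. *)
Lemma euler_peval p Y x : all (fun mo => mpoly.mdeg mo == p) (mpoly.msupp Y) ->
  \sum_(i < d) x ord0 i * peval (mpoly.mderiv i Y) x = p%:R * peval Y x.
Proof.
move=> /allP hom; rewrite /peval mpoly.mevalE mulr_sumr.
under eq_bigr => i _ do rewrite /mpoly.mderiv raddf_sum mulr_sumr.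
rewrite exchange_big /= big_seq [RHS]big_seq; apply: eq_bigr => m /hom /eqP <-.
rewrite mpoly.mdegE natr_sum mulr_suml; apply: eq_bigr => i _.
rewrite mpoly.mevalZ mpoly.mevalX [in LHS](bigD1 i) // [in RHS](bigD1 i) //=.
rewrite mpoly.mnmBE mpoly.mnm1E eqxx subn1.
rewrite [X in _ * (_ * (_ * X)) = _](eq_bigr (fun k => x ord0 k ^+ m k)); last first.
  by move=> k /negbTE ki; rewrite mpoly.mnmBE mpoly.mnm1E eq_sym ki subn0.
case: (m i) => [|l] /=; first by rewrite !(mul0r, mulr0).
by rewrite exprS; ring.
Qed.

Lemma sqnorm_line x i s :
  sqnorm (x + s *: delta_mx ord0 i) = sqnorm x + 2 * x ord0 i * s + s ^+ 2.
Proof.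
rewrite /sqnorm (bigD1 i) //= [in RHS](bigD1 i) //= line_coord eqxx.
rewrite (eq_bigr (fun k => x ord0 k ^+ 2)); first by ring.
by move=> k /negbTE ki; rewrite line_coord ki.
Qed.

(* The cross term 2 grad(q(|x|^2)).grad Y is 4 q' times the Euler operator
   applied to Y, hence 4 p q' Y. *)
Lemma laplacian_radial_harmonic p Y (q q1 q2 : R -> R) x (a : R) :
  harmonic_hom p Y ->
  (forall u, is_derive u (1 : R) q (q1 u)) ->
  (forall u, is_derive u (1 : R) q1 (q2 u)) ->
  \sum_(i < d) derive1 (derive1 (fun s : R =>
     a * q (sqnorm (x + s *: delta_mx ord0 i))
     * peval Y (x + s *: delta_mx ord0 i))) 0
  = a * (4 * sqnorm x * q2 (sqnorm x)
         + (2 * d%:R + 4 * p%:R) * q1 (sqnorm x)) * peval Y x.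
Proof.
move=> [hom harm] dq dq1; set w := sqnorm x.
(* The four summands are arranged so that summing over [i] gives [sqnorm x], the factor [d], the
   Euler operator and the Laplacian of [Y]. *)
have second i : derive1 (derive1 (fun s : R =>
     a * q (sqnorm (x + s *: delta_mx ord0 i))
     * peval Y (x + s *: delta_mx ord0 i))) 0
  = a * (4 * q2 w * peval Y x * x ord0 i ^+ 2
     + (2 * q1 w * peval Y x + (4 * q1 w * (x ord0 i * peval (mpoly.mderiv i Y) x)
     + q w * peval (mpoly.mderiv i (mpoly.mderiv i Y)) x))).
  pose z s := x + s *: delta_mx ord0 i.
  pose U s := w + 2 * x ord0 i * s + s ^+ 2.
  have dU s : is_derive s (1 : R) U (2 * x ord0 i + 2 * s).
    by rewrite /U; derive_to; ring.
  have dqU s : is_derive s (1 : R) (fun s => q (U s))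
      (q1 (U s) * (2 * x ord0 i + 2 * s)).
    exact: is_derive_fun_comp.
  have dq1U s : is_derive s (1 : R) (fun s => q1 (U s))
      (q2 (U s) * (2 * x ord0 i + 2 * s)).
    exact: is_derive_fun_comp.
  have dY s := is_derive_peval Y x i s.
  have dY1 s := is_derive_peval (mpoly.mderiv i Y) x i s.
  rewrite (_ : (fun s => _) = fun s => a * q (U s) * peval Y (z s)); last first.
    by apply/funext => s; rewrite sqnorm_line.
  have D1 : derive1 (fun s => a * q (U s) * peval Y (z s)) = fun s =>
      a * (q1 (U s) * (2 * x ord0 i + 2 * s)) * peval Y (z s)
      + a * q (U s) * peval (mpoly.mderiv i Y) (z s).
    by apply: derive1_fun => s; derive_to; ring.
  have D2 : derive1 (fun s => a * (q1 (U s) * (2 * x ord0 i + 2 * s)) * peval Y (z s)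
      + a * q (U s) * peval (mpoly.mderiv i Y) (z s)) = fun s =>
      a * (q2 (U s) * (2 * x ord0 i + 2 * s) ^+ 2 + 2 * q1 (U s)) * peval Y (z s)
      + 2 * a * (q1 (U s) * (2 * x ord0 i + 2 * s)) * peval (mpoly.mderiv i Y) (z s)
      + a * q (U s) * peval (mpoly.mderiv i (mpoly.mderiv i Y)) (z s).
    by apply: derive1_fun => s; derive_to; ring.
  have U0 : U 0 = w by rewrite /U; ring.
  have z0 : z 0 = x by rewrite /z scale0r addr0.
  by rewrite D1 D2 U0 z0; ring.
rewrite (eq_bigr _ (fun i _ => second i)) -mulr_sumr !big_split /=.
rewrite sumr_const card_ord -!mulr_sumr.
rewrite (euler_peval x hom).
have -> : \sum_(i < d) peval (mpoly.mderiv i (mpoly.mderiv i Y)) x = 0.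
  by rewrite /peval -raddf_sum harm raddf0.
by rewrite -[\sum_(i < d) _ ^+ 2]/(sqnorm x) -/w; ring.
Qed.

End Laplacian.

(** The derivatives of [g] and [h] are left as data, so one formula serves both the constant Jacobi
    factor and the one of positive degree. *)
Lemma wave_separated (R : realType) d p (Y : mpoly.mpoly d R) (g g1 g2 : R -> R)
    (h ht htt hu huu : R -> R -> R) (x : 'rV[R]_d) (t : R) :
  harmonic_hom p Y ->
  (forall s, is_derive s (1 : R) g (g1 s)) ->
  (forall s, is_derive s (1 : R) g1 (g2 s)) ->
  (forall u s, is_derive s (1 : R) (h u) (ht u s)) ->
  (forall u s, is_derive s (1 : R) (ht u) (htt u s)) ->
  (forall u s, is_derive u (1 : R) (fun w => h w s) (hu u s)) ->
  (forall u s, is_derive u (1 : R) (fun w => hu w s) (huu u s)) ->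
  let F := fun y s => g s * h (sqnorm y) s * peval Y y in
  let r := sqnorm x in
  d_tt F x t - lap_x F x t =
  (g2 t * h r t + 2 * g1 t * ht r t
   + g t * (htt r t - 4 * r * huu r t - (2 * d%:R + 4 * p%:R) * hu r t))
  * peval Y x.
Proof.
move=> hY dg dg1 dht dhtt dhu dhuu F r; rewrite /lap_x /F.
rewrite (@laplacian_radial_harmonic _ _ p Y (h^~ t) (hu^~ t) (huu^~ t)) // -/r.
rewrite /d_tt -/r.
have dhr s := dht r s; have dhtr s := dhtt r s.
have D1 : derive1 (fun s => g s * h r s * peval Y x) =
    fun s => (g1 s * h r s + g s * ht r s) * peval Y x.
  by apply: derive1_fun => s; derive_to; ring.
have D2 : derive1 (fun s => (g1 s * h r s + g s * ht r s) * peval Y x) =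
    fun s => (g2 s * h r s + 2 * g1 s * ht r s + g s * htt r s) * peval Y x.
  by apply: derive1_fun => s; derive_to; ring.
by rewrite D1 D2; ring.
Qed.

(** * Combination of the Laguerre and Jacobi identities, separately for [j = 0] and [j > 0] *)

Theorem theorem2p5 (R : realType) (d n m j : nat) (Y : mpoly.mpoly d R)
  (hd : (1 <= d)%N) (hmn : (m <= n)%N) (hj : (2 * j <= m)%N)
  (hY : harmonic_hom (m - 2 * j) Y) (x : 'rV[R]_d) (t : R) :
  let F := fun (y : 'rV[R]_d) (u : R) => expR (- u) * Qfun n m j (-1) Y y u in
  expR t * (d_tt F x t - lap_x F x t) =
    acoef R d m j *
      (Qfun n m j 0 Y x t
       - bcoef R m n *
           (if j == 0%N then 0 else Qfun n (m - 2) (j - 1) 0 Y x t)).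
Proof.
move=> F.
set alpha : R := 2 * m%:R + 2 * (-1) + d%:R.
set b : R := (m - 2 * j)%:R + (d%:R - 2) / 2.
pose g a s : R := expR (- s) * laguerre (n - m) a s.
have dg s := is_derive_exp_laguerre (n - m) alpha s.
have dg1 s : is_derive s (1 : R) (fun z => - g (alpha + 1) z) (g (alpha + 2) s).
  have ? := is_derive_exp_laguerre (n - m) (alpha + 1) s.
  by rewrite /g; derive_to; rewrite opprK -addrA.
have -> : F = fun y s => g alpha s * hjacobi j (-1) b (sqnorm y) s * peval Y y.
  by apply/funext => y; apply/funext => s; rewrite /F /Qfun !mulrA.
have expK : expR t * expR (- t) = 1 by rewrite expRN mulfV // gt_eqF ?expR_gt0.
have alpha2 : 2 * m%:R + 2 * 0 + d%:R = alpha + 2 by rewrite /alpha; ring.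
case: j {F} @b hj hY => [|l] b hj hY.
  (* In degree zero the Jacobi factor is [1] for both parameters, so only the second derivative of
     [g alpha] survives. *)
  have h0 (a u s : R) : hjacobi 0 a b u s = 1.
    by rewrite /hjacobi big_ord1 /poch !big_ord0 /= muln0 fact0 muln1; field.
  have dht u s : is_derive s (1 : R) (hjacobi 0 (-1) b u) 0.
    rewrite (_ : hjacobi _ _ _ _ = fun=> 1); first exact: is_derive_fun_cst.
    by apply/funext => w; rewrite h0.
  have dhu u s : is_derive u (1 : R) (fun w => hjacobi 0 (-1) b w s) 0.
    rewrite (_ : (fun w => _) = fun=> 1); first exact: is_derive_fun_cst.
    by apply/funext => w; rewrite h0.
  have d0 (u s : R) := is_derive_fun_cst (0 : R) s.
  have d0' (u s : R) := is_derive_fun_cst (0 : R) u.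
  have /= -> := wave_separated x t hY dg dg1 dht d0 dhu d0'.
  have -> : acoef R d m 0 = 1.
    rewrite /acoef muln0 subn0; case: eqP => // /eqP ne.
    by rewrite divff // subr_eq0 eqr_nat.
  rewrite /Qfun -/b alpha2 !h0 !(mulr0, subr0, addr0, mulr1, mul1r) /g.
  by rewrite !mulrA expK mul1r.
have dhtt u s : is_derive s (1 : R)
    (fun z => - 2 * (l.+1%:R + b) * z * hjacobi l 0 b u z)
    (- 2 * (l.+1%:R + b) * (hjacobi l 0 b u s + s * hjacobi0_dt l b u s)).
  have ? := is_derive_hjacobi0_t l b u s.
  by derive_to; ring.
have /= -> := wave_separated x t hY dg dg1 (is_derive_hjacobiN1_t l b) dhtt
  (is_derive_hjacobiN1_u l b) (is_derive_hjacobiN1_uu l b).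
set r := sqnorm x.
have ml : m%:R = (m - 2 * l.+1)%:R + 2 * l.+1%:R :> R.
  by rewrite -natrM -natrD subnK.
(* This matches the first-order coefficient of the Laplacian with that of [hjacobiN1_wave]. *)
have degE : 2 * d%:R + 4 * (m - 2 * l.+1)%:R = 4 * b + 4 :> R.
  by rewrite /b; field.
have alphaE : alpha = 2 * (2 * l.+1%:R + b).
  by rewrite /alpha /b ml; field.
(* As [2 * l.+1 <= m] forces [m >= 2], the number [alpha = 2m + d - 2] is positive; this also
   excludes the exceptional branch of [acoef]. *)
have alpha_neq0 : 2 * l.+1%:R + b != 0.
  suff : alpha != 0 by rewrite alphaE mulf_eq0 negb_or => /andP[].
  rewrite (_ : alpha = (2 * m + d - 2)%:R) ?pnatr_eq0; first by lia.
  by rewrite natrB ?natrD ?natrM /alpha; [ring|lia].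
have acoefE : acoef R d m l.+1 = (l.+1%:R + b) / (2 * l.+1%:R + b).
  rewrite /acoef ifF; last by apply/eqP; lia.
  have -> : (2 * m + d)%:R - 2 = alpha.
    by rewrite natrD natrM /alpha; ring.
  have -> : (2 * m - 2 * l.+1 + d)%:R - 2 = 2 * (l.+1%:R + b) :> R.
    rewrite natrD natrB ?natrM; last by lia.
    by rewrite /b ml; field.
  by rewrite alphaE -mulf_div divff ?mul1r // pnatr_eq0.
have bcoefE : bcoef R m n = ((n - m).+1 * (n - m).+2)%:R.
  by rewrite /bcoef addn1 addn2.
rewrite degE hjacobiN1_wave acoefE bcoefE /Qfun alpha2 -/b subn1 /=.
(* Passing from [(m, j)] to [(m - 2, j - 1)] keeps the degree of [Y] and hence [b], raises the
   Laguerre degree by two and lowers its parameter from [alpha + 2] to [alpha - 2]. *)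
have -> : (n - (m - 2) = (n - m).+2)%N by lia.
have -> : (m - 2 - 2 * l = m - 2 * l.+1)%N by lia.
have -> : 2 * (m - 2)%:R + 2 * 0 + d%:R = alpha - 2.
  by rewrite natrB ?/alpha; [ring|lia].
rewrite -/b -/r.
have := laguerre_contiguous2 (n - m) alpha t.
have := hjacobi_diff l b r t.
rewrite /g.
set L0 := laguerre _ alpha t; set L1 := laguerre _ (alpha + 1) t.
set L2 := laguerre _ (alpha + 2) t; set LL := laguerre _ (alpha - 2) t.
set h := hjacobi _ (-1) _ _ _; set K := hjacobi l 0 _ _ _.
set K1 := hjacobi l.+1 0 _ _ _.
set B := ((n - m).+1 * (n - m).+2)%:R; set y := peval Y x.
move=> hE LE.
have {}hE : h = (l.+1%:R + b) * (K1 - t ^+ 2 * K) / (2 * l.+1%:R + b).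
  by rewrite -hE mulrC mulKf.
(* From [alphaE], [4 * l%:R + 2 * b + 3] is [alpha - 1]. Once [h] is replaced by [hE], the
   coefficient of [K] is therefore [- (l.+1%:R + b) / (2 * l.+1%:R + b)] times the right side of
   [laguerre_contiguous2]. *)
transitivity (expR t * expR (- t) * (L2 * h + 4 * L1 * (l.+1%:R + b) * t * K
   - 2 * (l.+1%:R + b) * (4 * l%:R + 2 * b + 3) * L0 * K) * y); first by ring.
transitivity ((l.+1%:R + b) / (2 * l.+1%:R + b) * (L2 * K1 - (B * LL) * K) * y);
  last by ring.
by rewrite expK LE hE alphaE -natr1; field; rewrite natr1.
Qed.
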